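(* Let $G$ be a multigraph with maximum degree at most $3$, with $n$ vertices, exactly $c$ cut-edges, and $1$-deficit $d=3n-2|E(G)|$. Then $$f_2(G)\ge n-\max\left\{0,\tfrac{d+c-1}{2}\right\}.$$ Moreover, this bound is sharp: there exist such multigraphs with arbitrarily many vertices for which equality holds.
   Context: Multigraphs are finite and may have loops and multiple edges; a loop contributes $2$ to the degree of its vertex, so the degree-sum is $2|E(G)|$. The $1$-deficit of an $n$-vertex multigraph $G$ of maximum degree at most $3$ is $3n-2|E(G)|$. A cut-edge is an edge whose deletion increases the number of connected components. A subgraph is $2$-regular if every vertex of it has degree $2$ in it. $f_2(G)$ denotes the maximum number of vertices in a $2$-regular subgraph of $G$ (taken to be $0$ if none exists). *)

(* Defs.v *)
From HB Require Import structures.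
From mathcomp Require Import all_boot all_order all_algebra.

Set Implicit Arguments.
Unset Strict Implicit.
Unset Printing Implicit Defensive.

Import Order.TTheory GRing.Theory Num.Theory.

(* The order of the two components of [ends e] carries no meaning: every notion
   below is invariant under swapping them. A loop is an edge with equal ends. *)
Record multigraph := Multigraph {
  vert : finType;
  edge : finType;
  ends : edge -> vert * vert
}.

Section MultigraphNotions.
Variable G : multigraph.
Implicit Types (e : edge G) (v : vert G) (F : {set edge G}).

Definition deg_in F v : nat :=
  \sum_(e in F) (((ends e).1 == v) + ((ends e).2 == v)).

Definition max_degree : nat := \max_v deg_in setT v.

Definition adj_in F : rel (vert G) :=
  fun u v => [exists e in F, (ends e == (u, v)) || (ends e == (v, u))].

(* Number of connected components of the spanning subgraph with edge set F. *)
Definition ncomp F : nat := n_comp (adj_in F) predT.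

Definition cut_edge e : bool := ncomp setT < ncomp [set~ e].

Definition num_cut_edges : nat := #|[set e | cut_edge e]|.

Definition deficit : int := (3 * #|vert G|%:Z - 2 * #|edge G|%:Z)%R.

Definition subgraph (H : {set vert G} * {set edge G}) : bool :=
  [forall e in H.2, ((ends e).1 \in H.1) && ((ends e).2 \in H.1)].

Definition two_regular (H : {set vert G} * {set edge G}) : bool :=
  [forall v in H.1, deg_in H.2 v == 2].

Definition f2 : nat := \max_(H | subgraph H && two_regular H) #|H.1|.

End MultigraphNotions.

(* Main.v *)
Require Import Defs.
From HB Require Import structures.
From mathcomp Require Import all_boot all_order all_algebra.
From mathcomp Require Import zify lra.

(** In a multigraph of maximum degree at most 3, the 2-regular subgraphs are
    the even edge sets (all degrees even), and such a set has as many edges as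
    covered vertices.  A maximum even set C is the complement of a minimum
    T-join J, where T is the set of odd-degree vertices, and C avoids cut-edges.
    Delete the cut-edges and look at a component K of what remains: all its odd
    cuts have at least 3 edges, so a packing of T-cuts as in Seymour's theorem
    gives [3 |J :&: E(K)| <= |E(K)|].  Hence K has at most [d_K / 3] uncovered
    vertices, where d_K is the deficit of K, and this is at most [(d_K - 1) / 2]
    if d_K > 0.  Sum over the components: the d_K add up to d + 2c, and if some
    d_K is positive then at least c + 1 of them are, because the cut-edges form a
    forest on the components of positive deficit. *)

Set Implicit Arguments.
Unset Strict Implicit.
Unset Printing Implicit Defensive.

Import Order.TTheory GRing.Theory Num.Theory.

(** * Edge sets, joins and cuts *)

Section EdgeSets.
Variable G : multigraph.
Implicit Types (e f : edge G) (u v x y : vert G) (A B Q : {set edge G}).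
Implicit Types (X : {set vert G}).

(** The exclusive or keeps loops out of every cut. *)
Definition cut X : {set edge G} :=
  [set e | ((ends e).1 \in X) (+) ((ends e).2 \in X)].

Definition inside Q X : {set edge G} :=
  [set e in Q | ((ends e).1 \in X) && ((ends e).2 \in X)].

(* For x = y this says that all degrees are even. *)
Definition ejoin Q x y := forall v, odd (deg_in Q v) = (v == x) (+) (v == y).

Definition even_set Q := forall v, ~~ odd (deg_in Q v).

Definition symdiff A B : {set edge G} := [set e | (e \in A) (+) (e \in B)].

Lemma deg_inID Q A v : deg_in Q v = deg_in (Q :&: A) v + deg_in (Q :\: A) v.
Proof. exact: big_setID. Qed.

Lemma deg_in_sub Q A v : A \subset Q -> deg_in A v <= deg_in Q v.
Proof. by move=> sAQ; rewrite (deg_inID Q A) (setIidPr sAQ) leq_addr. Qed.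

Lemma deg_in0 v : deg_in set0 v = 0 :> nat.
Proof. exact: big_set0. Qed.

Lemma deg_in1 e v : deg_in [set e] v = ((ends e).1 == v) + ((ends e).2 == v).
Proof. exact: big_set1. Qed.

Lemma odd_deg_symdiff A B v :
  odd (deg_in (symdiff A B) v) = odd (deg_in A v) (+) odd (deg_in B v).
Proof.
rewrite (deg_inID (symdiff A B) A) (deg_inID A B) (deg_inID B A).
have ->: symdiff A B :&: A = A :\: B.
  by apply/setP=> e; rewrite !inE; do 2 case: (e \in _).
have ->: symdiff A B :\: A = B :\: A.
  by apply/setP=> e; rewrite !inE; do 2 case: (e \in _).
rewrite (setIC B A) !oddD.
by case: (odd _); case: (odd _); case: (odd _).
Qed.

Lemma symdiff_sub A B : B \subset A -> symdiff A B = A :\: B.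
Proof.
move=> sBA; apply/setP=> e; rewrite !inE.
by have := subsetP sBA e; case: (e \in B); case: (e \in A) => // ->.
Qed.

Lemma symdiff_disj A B : [disjoint A & B] -> symdiff A B = A :|: B.
Proof.
move=> dAB; apply/setP=> e; rewrite !inE.
by have := disjointFr dAB (x := e); case: (e \in A); case: (e \in B) => // ->.
Qed.

(** Double counting: an edge is counted once for each of its ends in [X]. Modulo 2 only the crossing
    edges survive, which is the source of all parity arguments below. *)
Lemma sum_deg_in Q X :
  \sum_(v in X) deg_in Q v = #|Q :&: cut X| + (#|inside Q X|).*2.
Proof.
rewrite /deg_in exchange_big /=.
have sumX a : \sum_(v in X) (a == v : nat) = (a \in X).
  rewrite big_mkcond /= (bigD1 a) //= eqxx big1 ?addn0; first by case: (a \in X).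
  by move=> v /negPf; rewrite eq_sym => ->; case: ifP.
rewrite -!sum1_card -muln2 big_distrl /= [X in _ = X + _]big_mkcond.
rewrite [X in _ = _ + X]big_mkcond [LHS]big_mkcond -big_split /=.
apply: eq_bigr => e _; rewrite big_split /= !sumX !inE.
by case: (e \in Q); case: (_ \in X); case: (_ \in X).
Qed.

Lemma odd_card_cut Q X :
  odd #|Q :&: cut X| = odd (\sum_(v in X) deg_in Q v).
Proof. by rewrite sum_deg_in oddD odd_double addbF. Qed.

Lemma odd_sum (T : finType) (P : pred T) (F : T -> nat) :
  odd (\sum_(i | P i) F i) = \big[addb/false]_(i | P i) odd (F i).
Proof. exact: (big_morph odd oddD (erefl (odd 0))). Qed.

Lemma even_set_cut Q X : even_set Q -> ~~ odd #|Q :&: cut X|.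
Proof.
move=> eQ; rewrite odd_card_cut odd_sum big1 // => v _; exact: negPf (eQ v).
Qed.

Lemma ejoin_cut Q x y X :
  ejoin Q x y -> odd #|Q :&: cut X| = (x \in X) (+) (y \in X).
Proof.
move=> jQ; rewrite odd_card_cut odd_sum.
under eq_bigr => v _ do rewrite jQ.
have sumX a : \big[addb/false]_(v in X) (v == a) = (a \in X).
  rewrite big_mkcond /= (bigD1 a) //= eqxx big1 ?addbF; first by case: (a \in X).
  by move=> v /negPf ->; case: ifP.
by rewrite big_split /= !sumX.
Qed.

Lemma ejoinxx Q x : ejoin Q x x <-> even_set Q.
Proof.
split=> jQ v; first by rewrite jQ addbb.
by rewrite addbb (negPf (jQ v)).
Qed.

Lemma ejoinC Q x y : ejoin Q x y -> ejoin Q y x.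
Proof. by move=> jQ v; rewrite jQ addbC. Qed.

(** Concatenation of paths modulo 2: the parities at the middle vertex [y] cancel. *)
Lemma ejoin_symdiff A B x y z : ejoin A x y -> ejoin B y z -> ejoin (symdiff A B) x z.
Proof.
move=> jA jB v; rewrite odd_deg_symdiff jA jB.
by rewrite addbA -(addbA (v == x)) addbb addbF.
Qed.

Lemma ejoin1 e : ejoin [set e] (ends e).1 (ends e).2.
Proof.
move=> v; rewrite deg_in1 oddD ![_ == v]eq_sym.
by case: (v == _); case: (v == _).
Qed.

Lemma even_symdiff A B : even_set A -> even_set B -> even_set (symdiff A B).
Proof.
by move=> eA eB v; rewrite odd_deg_symdiff (negPf (eA v)) (negPf (eB v)).
Qed.

Lemma even_setD A B : even_set A -> even_set B -> B \subset A -> even_set (A :\: B).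
Proof. by move=> eA eB sBA; rewrite -symdiff_sub //; apply: even_symdiff. Qed.

Lemma even_set_ejoin Q x y : ejoin Q x y -> even_set Q -> x = y.
Proof.
move=> jQ eQ; apply/eqP; have := jQ x.
by rewrite eqxx (negPf (eQ x)); case: eqP.
Qed.

Lemma cut1_ejoin e v : e \in cut [set v] ->
  exists2 u, u != v & ejoin [set e] u v.
Proof.
rewrite !inE; have je := ejoin1 e.
case: (eqVneq (ends e).1 v) => [<-|n1] /=.
  by move=> n2; exists (ends e).2 => //; apply: ejoinC.
by move/eqP=> E2; exists (ends e).1 => //; rewrite -E2.
Qed.

Lemma adj_in_sym Q : symmetric (adj_in Q).
Proof. by move=> u v; apply: eq_existsb => e; rewrite orbC. Qed.

Lemma connect_adj_sym Q : connect_sym (adj_in Q).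
Proof. exact: sym_connect_sym (@adj_in_sym Q). Qed.

Lemma adj_in_ends Q e : e \in Q -> adj_in Q (ends e).1 (ends e).2.
Proof.
by move=> Qe; apply/existsP; exists e; rewrite Qe -surjective_pairing eqxx.
Qed.

Lemma sub_adj_in A B : A \subset B -> subrel (adj_in A) (adj_in B).
Proof.
move=> sAB u v /existsP[e /andP[Ae h]]; apply/existsP; exists e.
by rewrite (subsetP sAB).
Qed.

Lemma adj_in_ejoin Q u v : adj_in Q u v -> exists2 e, e \in Q & ejoin [set e] u v.
Proof.
case/existsP=> e /andP[Qe /orP[]/eqP Ee]; exists e => //; have := ejoin1 e;
  rewrite Ee //=; exact: ejoinC.
Qed.

(** Adds up the edges of a walk modulo 2. Such joins stand in for paths throughout, so simple paths
    never have to be extracted. *)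
Lemma connect_ejoin Q x y : connect (adj_in Q) x y ->
  exists2 P : {set edge G}, P \subset Q & ejoin P x y.
Proof.
case/connectP=> p; elim: p x => [|z p IH] x /=.
  move=> _ ->; exists set0; first exact: sub0set.
  by apply/ejoinxx => v; rewrite deg_in0.
case/andP=> /adj_in_ejoin[e Qe je] /IH{}IH /IH[P sPQ jP].
exists (symdiff [set e] P); last exact: ejoin_symdiff je jP.
apply/subsetP=> f; rewrite !inE; case: eqP => [->//|_ /=]; exact: (subsetP sPQ).
Qed.

Definition component Q v : {set vert G} := [set u | connect (adj_in Q) v u].

Lemma component_refl Q v : v \in component Q v.
Proof. by rewrite inE connect0. Qed.

Lemma component_ends Q v e : e \in Q ->
  ((ends e).1 \in component Q v) = ((ends e).2 \in component Q v).
Proof.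
move/adj_in_ends/connect1=> h; rewrite !inE.
apply/idP/idP=> h1; apply: (connect_trans h1) => //.
by rewrite connect_adj_sym.
Qed.

Lemma component_cut Q v A : A \subset Q -> A :&: cut (component Q v) = set0.
Proof.
move=> sAQ; apply/setP=> e; rewrite in_set0 in_setI in_set.
by case Ae: (e \in A) => //=; rewrite (@component_ends Q) ?addbb ?(subsetP sAQ).
Qed.

Lemma deg_inside A X v :
  A :&: cut X = set0 -> deg_in (inside A X) v = if v \in X then deg_in A v else 0.
Proof.
move=> A0; rewrite {1}/deg_in /inside.
under eq_bigl => e do rewrite in_set.
have E e : e \in A -> ((ends e).1 \in X) = ((ends e).2 \in X).
  move=> Ae; have /setP/(_ e) := A0; rewrite in_set0 in_setI Ae in_set /=.
  by case: (_ \in X); case: (_ \in X).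
case: ifPn => Xv.
  rewrite big_mkcond [RHS]big_mkcond; apply: eq_bigr => e _ /=.
  case Ae: (e \in A) => //=; rewrite (E _ Ae) andbb.
  case: ifPn => // h; move: (h); rewrite -(E _ Ae) => h'.
  have ne a : a \notin X -> (a == v) = false.
    by apply: contraNF => /eqP->.
  by rewrite !ne.
apply: big1 => e /and3P[Ae h1 h2].
have ne a : a \in X -> (a == v) = false.
  by move=> Xa; apply: contraNF Xv => /eqP<-.
by rewrite !ne.
Qed.

Lemma even_inside A X : even_set A -> A :&: cut X = set0 -> even_set (inside A X).
Proof. by move=> eA A0 v; rewrite deg_inside //; case: ifP. Qed.

(* A path from x reaches t through a single edge: consider the component of x
   once the edges at t are removed. *)
Lemma ejoin_last_edge Q x t : x != t -> ejoin Q x t ->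
  exists f a (R : {set edge G}), [/\ f \in Q :&: cut [set t], ejoin [set f] a t,
                    R \subset Q :\: cut [set t] & ejoin R x a].
Proof.
move=> nxt jQ; set Q' := Q :\: cut [set t]; set W := component Q' x.
have tW : t \notin W.
  apply/negP; rewrite inE => /connect_ejoin[P sP jP].
  have := ejoin_cut [set t] jP; rewrite !inE eqxx (negPf nxt) /=.
  suff ->: P :&: cut [set t] = set0 by rewrite cards0.
  apply/setP=> e; rewrite in_set0 in_setI; apply/negP => /andP[/(subsetP sP)].
  by rewrite in_setD => /andP[/negPf->].
have := ejoin_cut W jQ; rewrite component_refl (negPf tW) /= => oW.
have [f] : exists f, f \in Q :&: cut W.
  by apply/set0Pn/eqP => h; move: oW; rewrite h cards0.
rewrite in_setI => /andP[Qf Wf].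
have tf : f \in cut [set t].
  apply: contraLR Wf => tf; rewrite in_set (@component_ends Q') ?addbb //.
  by rewrite in_setD tf.
have [a nat_ ja] := cut1_ejoin tf.
have aW : a \in W.
  have := ejoin_cut W ja; rewrite (negPf tW) addbF => <-.
  suff ->: [set f] :&: cut W = [set f] by rewrite cards1.
  by apply/setIidPl; rewrite sub1set.
move: aW; rewrite inE => /connect_ejoin[R sR jR].
by exists f, a, R; split; rewrite ?in_setI ?Qf.
Qed.

End EdgeSets.

(** * Conservative weightings *)

Section SignedLength.
Variables (E : finType) (J : {set E}).
Implicit Types (l : E -> nat) (A B Q : {set E}).

(** Since exchanging [J] along [Q] changes its total length by [slen l Q], nonnegativity on all even
    sets says that no such exchange shortens [J]. *)
Definition slen l Q : int :=
  \sum_(e in Q) (if e \in J then - (l e)%:Z else (l e)%:Z)%R.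

Lemma slenID l A B : slen l A = (slen l (A :&: B) + slen l (A :\: B))%R.
Proof. exact: big_setID. Qed.

Lemma slen_sub l A B : B \subset A -> slen l A = (slen l B + slen l (A :\: B))%R.
Proof. by move=> sBA; rewrite (slenID l A B) (setIidPr sBA). Qed.

Lemma slen_disj l A B :
  [disjoint A & B] -> slen l (A :|: B) = (slen l A + slen l B)%R.
Proof.
move=> dAB; rewrite (slen_sub l (subsetUl A B)) setDUl setDv set0U.
by congr (_ + slen _ _)%R; apply/setDidPl; rewrite disjoint_sym.
Qed.

Lemma slen1 l e : slen l [set e] = (if e \in J then - (l e)%:Z else (l e)%:Z)%R.
Proof. exact: big_set1. Qed.

(** Written without subtraction, so that comparisons with cardinalities become linear arithmetic. *)
Lemma slenE l Q :
  (slen l Q + (\sum_(e in Q :&: J) l e)%N%:Z = (\sum_(e in Q :\: J) l e)%N%:Z)%R.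
Proof.
have h (A : {set E}) (F : E -> nat) :
    ((\sum_(e in A) F e)%N%:Z = \sum_(e in A) (F e)%:Z)%R.
  exact: (big_morph Posz PoszD (erefl _)).
rewrite (slenID _ _ J) !h /slen.
under eq_bigr => e /setIP[_ ->] do over.
under [X in (_ + X + _)%R]eq_bigr => e /setDP[_ /negPf->] do over.
by rewrite sumrN addrAC addNr add0r.
Qed.

Lemma odd_slen l Q k : slen l Q = Posz k -> odd k = odd (\sum_(e in Q) l e).
Proof.
move=> sk; rewrite (big_setID J) /=; have := slenE l Q; rewrite sk.
move: (\sum_(e in Q :&: J) l e) (\sum_(e in Q :\: J) l e) => a b.
by rewrite -PoszD => -[<-]; rewrite !oddD; case: (odd a); case: (odd k).
Qed.

End SignedLength.

(** * Shortening the star of a tight vertex *)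

Section TightVertex.
Variable G : multigraph.
Variables (J : {set edge G}) (l : edge G -> nat) (col : vert G -> bool).
Hypothesis zero_loop : forall e, l e = 0 -> (ends e).1 = (ends e).2.
Hypothesis l_parity : forall e, odd (l e) = col (ends e).1 (+) col (ends e).2.
Hypothesis conserv : forall C, even_set C -> (0 <= slen J l C)%R.

Let N := #|edge G|.+1.
(* Minimizing [mu] means minimizing the signed length first, then the number of
   edges; nonempty even sets have positive [mu]. *)
Let mu (Q : {set edge G}) : int := (slen J l Q * N%:Z + #|Q|%:Z)%R.

Lemma cut1_len e t : e \in cut [set t] -> 0 < l e.
Proof.
rewrite lt0n => te; apply/eqP => /zero_loop; move: te.
by rewrite inE => /[swap] ->; rewrite addbb.
Qed.

Lemma mu_sub (A B : {set edge G}) : B \subset A -> mu A = (mu B + mu (A :\: B))%R.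
Proof.
move=> sBA; rewrite /mu (slen_sub J l sBA).
have := cardsID B A; rewrite (setIidPr sBA) => <-.
by rewrite PoszD mulrDl; lia.
Qed.

Lemma mu_disj (A B : {set edge G}) :
  [disjoint A & B] -> mu (A :|: B) = (mu A + mu B)%R.
Proof.
move=> dAB; rewrite (mu_sub (subsetUl A B)) setDUl setDv set0U.
by congr (_ + mu _)%R; apply/setDidPl; rewrite disjoint_sym.
Qed.

Lemma mu1J f : f \in J -> 0 < l f -> (mu [set f] < 0)%R.
Proof.
move=> Jf lf; rewrite /mu slen1 Jf cards1 /N.
by have := max_card [set f]; rewrite cards1; nia.
Qed.

Lemma mu1NJ f : f \notin J -> 0 < l f -> (N%:Z < mu [set f])%R.
Proof. by move=> Jf lf; rewrite /mu slen1 (negPf Jf) cards1; nia. Qed.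

Lemma mu_even_gt0 C : even_set C -> C != set0 -> (0 < mu C)%R.
Proof.
move=> eC; rewrite -card_gt0 => C0; have := conserv eC.
by rewrite /mu => h; apply: ltr_wpDl; rewrite ?mulr_ge0 //; lia.
Qed.

(** By [l_parity] the length of [C] has the parity of its intersection with the cut between the two
    colour classes, which an even set meets evenly; signs do not matter modulo 2. *)
Lemma even_slen_even C : even_set C -> (slen J l C != 0)%R -> (2 <= slen J l C)%R.
Proof.
move=> eC; have := conserv eC; case E : (slen J l C) => [k|] // _.
have := odd_slen E; rewrite odd_sum.
under eq_bigr => e _ do rewrite l_parity.
have -> : \big[addb/false]_(e in C) (col (ends e).1 (+) col (ends e).2)
   = odd #|C :&: cut [set v | col v]|.
  rewrite -sum1_card odd_sum big_mkcond [RHS]big_mkcond; apply: eq_bigr => e _.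
  by rewrite !inE; case: (e \in C) => //=; case: (_ (+) _).
by rewrite (negPf (even_set_cut _ eC)); lia.
Qed.

(** The vertex [t] is an end of an [ejoin] [P] that minimizes [mu] over all pairs of ends. An even
    set that became negative by the shortening could be used to improve [P]. *)
Lemma tight_vertex : (exists2 j, j \in J & 0 < l j) ->
  exists t e, J :&: cut [set t] = [set e] /\
    forall C, even_set C ->
      (0 <= slen J (fun f => l f - (f \in cut [set t]))%N C)%R.
Proof.
case=> j Jj lj.
pose joinb (p : vert G * vert G * {set edge G}) :=
  [forall v, odd (deg_in p.2 v) == (v == p.1.1) (+) (v == p.1.2)].
have joinP p : reflect (ejoin p.2 p.1.1 p.1.2) (joinb p) by apply: 'forall_eqP.
have j0 : joinb ((ends j).1, (ends j).2, [set j]) by apply/joinP/ejoin1.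
case: (arg_minP (fun p : vert G * vert G * {set edge G} => mu p.2) j0).
move=> [[x t] P] /joinP/= jP minP.
have {}minP x' t' P' : ejoin P' x' t' -> (mu P <= mu P')%R.
  by move=> h; apply: (minP (x', t', P')); apply/joinP.
have muP : (mu P < 0)%R.
  apply: le_lt_trans (minP _ _ _ (ejoin1 j)) _.
  exact: mu1J.
have nxt : x != t.
  apply/eqP=> xt; rewrite -xt in jP; move/ejoinxx: jP => eP.
  have := conserv eP; move: muP; rewrite /mu => h1 h2.
  by have := mulr_ge0 h2 (isT : 0 <= Posz N)%R; lia.
(* Otherwise adding or removing [f] moves the end [t] to the other end of [f] and decreases [mu]. *)
have atP f : f \in cut [set t] -> (f \in P) = (f \in J).
  move=> tf; have [a _ ja] := cut1_ejoin tf; have lf := cut1_len tf.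
  have jPf : ejoin (symdiff P [set f]) x a by exact: ejoin_symdiff jP (ejoinC ja).
  have := minP _ _ _ jPf.
  case Pf : (f \in P); case Jf : (f \in J) => //.
    have sfP : [set f] \subset P by rewrite sub1set.
    rewrite symdiff_sub // (mu_sub sfP); have := mu1NJ (negbT Jf) lf; lia.
  have dPf : [disjoint P & [set f]] by rewrite disjoint_sym disjoints1 Pf.
  by rewrite symdiff_disj // mu_disj //; have := mu1J Jf lf; lia.
(* The difference is an even set, which has positive [mu] unless it is empty. *)
have minPsub (R : {set edge G}) : R \subset P -> ejoin R x t -> R = P.
  move=> sRP jR; have eD : even_set (P :\: R).
    by rewrite -symdiff_sub //; apply/(ejoinxx _ x)/(ejoin_symdiff jP (ejoinC jR)).
  have := minP _ _ _ jR; rewrite (mu_sub sRP).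
  case: (eqVneq (P :\: R) set0) => [/eqP|/(mu_even_gt0 eD)]; last by lia.
  by rewrite setD_eq0 => sPR _; apply/eqP; rewrite eqEsubset sRP.
have [e [a [R [ePt ja sR jR]]]] := ejoin_last_edge nxt jP.
(* The set [R] together with [e] already joins [x] to [t], so it is all of [P], and [R] avoids the
   star of [t]. *)
have {a R ja sR jR} Pt : P :&: cut [set t] = [set e].
  have eR : e \notin R.
    by apply/negP=> /(subsetP sR); move: ePt; rewrite !in_setI in_setD => /andP[_ ->].
  have <- : R :|: [set e] = P.
    apply: minPsub.
      rewrite subUset sub1set; move: ePt; rewrite in_setI => /andP[-> _].
      by rewrite (subset_trans sR) ?subsetDl.
    rewrite -symdiff_disj; first exact: ejoin_symdiff jR ja.
    by rewrite disjoint_sym disjoints1.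
  rewrite setIUl; have -> : R :&: cut [set t] = set0.
    apply/eqP; rewrite setI_eq0 disjoints_subset; apply: (subset_trans sR).
    by rewrite setDE subsetIr.
  rewrite set0U; apply/setIidPl; rewrite sub1set.
  by move: ePt; rewrite in_setI => /andP[].
have Jt : J :&: cut [set t] = [set e].
  rewrite -Pt; apply/setP=> f; rewrite !in_setI.
  by case tf: (f \in cut _); rewrite ?andbF // atP.
exists t, e; split=> // C.
have {}Jt f : f \in cut [set t] -> (f \in J) = (f == e).
  by move=> tf; move/setP/(_ f): Jt; rewrite in_setI tf andbT in_set1.
set l' := fun f => _; pose c f := nat_of_bool (f \in cut [set t]).
have slen' Q : slen J l' Q = (slen J l Q - slen J c Q)%R.
  rewrite /slen -sumrB; apply: eq_bigr => f _; rewrite /l' /c.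
  case tf: (f \in cut _); [have := cut1_len tf | ];
    case: (f \in J); rewrite ?subn0 /=; lia.
have slenc Q : slen J c Q = slen J c (Q :&: cut [set t]).
  rewrite (slenID J c Q (cut [set t])) [X in (_ + X)%R]big1 ?addr0 //.
  by move=> f /setDP[_ /negPf tf]; rewrite /c tf; case: ifP.
have [k] := ubnP #|C|; elim: k C => // k IH C Ck eC.
rewrite leNgt; apply/negP=> neg.
(* A smallest even set of negative new length is a circuit; it meets the star of t
   in two edges f and g, and by parity its old length is 0 unless it contains e. *)
have circ (D : {set edge G}) : D \subset C -> even_set D -> D != set0 -> D = C.
  move=> sDC eD D0; apply/eqP; rewrite eqEsubset sDC /= -setD_eq0.
  apply: contraLR neg => CD0; rewrite -leNgt (slen_sub J l' sDC).
  have := cardsID D C; rewrite (setIidPr sDC) => card_C.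
  move: D0 CD0; rewrite -!card_gt0 => D0 CD0.
  by apply: addr_ge0; apply: IH => //; [lia | lia | apply: even_setD].
case: (set_0Vmem (C :&: cut [set t])) => [Ct0 | [f]].
  by move: neg; rewrite slen' slenc Ct0 [slen J c _]big_set0 subr0 ltNge conserv.
rewrite in_setI => /andP[Cf tf].
have sfC : [set f] \subset C by rewrite sub1set.
have [a _ ja'] := cut1_ejoin tf.
have jCf : ejoin (C :\: [set f]) a t.
  by rewrite -symdiff_sub //; apply: ejoin_symdiff ja'; apply/ejoinxx.
have nat_ : a != t.
  have := ja' t; rewrite deg_in1 eqxx; move: tf.
  by rewrite !inE oddD !oddb => ->; case: eqVneq.
have [g [b [R [gCt jb sR jR]]]] := ejoin_last_edge nat_ jCf.
have [Cg nfg tg] : [/\ g \in C, g != f & g \in cut [set t]].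
  by move: gCt; rewrite in_setI in_setD in_set1 => /andP[/andP[-> ->] ->].
have RP h : h \in R -> [/\ h \in C, h != f & h \notin cut [set t]].
  by move/(subsetP sR); rewrite !in_setD in_set1 => /and3P[-> -> ->].
(* Closing [R] through [g] and [f] gives a nonempty even subset of [C], hence [C] itself. *)
have Ct : C :&: cut [set t] = [set g; f].
  have <- : R :|: [set g] :|: [set f] = C.
    apply: circ.
    - rewrite !subUset !sub1set Cg Cf !andbT; apply/subsetP=> h.
      by case/RP.
    - rewrite -symdiff_disj; last first.
        rewrite disjoint_sym disjoints1 in_setU in_set1 eq_sym (negPf nfg) orbF.
        by apply/negP=> /RP[_ _]; rewrite tf.
      rewrite -symdiff_disj; last first.
        by rewrite disjoint_sym disjoints1; apply/negP=> /RP[_ _]; rewrite tg.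
      apply/(ejoinxx _ a); apply: ejoin_symdiff (ejoinC ja').
      exact: ejoin_symdiff jR jb.
    by apply/set0Pn; exists f; rewrite !inE eqxx orbT.
  apply/setP=> h; rewrite in_setI !in_setU !in_set1 -orbA.
  case Rh: (h \in R) => /=.
    have [_ nhf th] := RP _ Rh; rewrite (negPf nhf) orbF (negPf th).
    by apply/esym/eqP=> hg; rewrite hg tg in th.
  by case: eqP => [->|_] //=; case: eqP => [->|].
have slencC : slen J c C = ((if g == e then -1 else 1) + (if f == e then -1 else 1))%R.
  rewrite slenc Ct [slen _ _ _]big_setU1 ?in_set1 //= big_set1 /c tf tg.
  by rewrite !Jt.
(* If [e] were in [C], its sign would cancel that of the other star edge, and the shortening would
   leave the length of [C] unchanged. *)
have eC' : e \notin C.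
  apply/negP=> Ce; have : e \in C :&: cut [set t].
    by rewrite in_setI Ce; move: ePt; rewrite in_setI => /andP[].
  move: neg; rewrite slen' slencC Ct !inE; move: nfg.
  case: (eqVneq g e) => [->|nge] nfg; rewrite eq_sym in nfg.
    by rewrite (negPf nfg) addNr subr0 ltNge conserv.
  move=> /[swap] /eqP<-.
  by rewrite eqxx subrr subr0 ltNge conserv.
(* The shortening costs at most 2, and a nonzero old length is at least 2. *)
have sC0 : slen J l C = 0.
  apply/eqP; apply: contraLR neg => /(even_slen_even eC).
  rewrite slen' slencC -leNgt subr_ge0; apply: le_trans.
  by case: ifP; case: ifP.
have muC : (mu C < N)%R by rewrite /mu sC0 mul0r add0r ltz_nat ltnS max_card.
have Nfl : (N%:Z < mu [set f])%R.
  by apply: mu1NJ (cut1_len tf); rewrite Jt //; apply: contraNneq eC' => <-.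
(* If [P] and [C] are disjoint, extending [P] by [C] minus [f] yields a join from [x] to [a] of
   smaller [mu], because [mu C < N < mu [set f]]. *)
case: (set_0Vmem (P :&: C)) => [PC0|[h]].
  have dP : [disjoint P & C :\: [set f]].
    by rewrite -setI_eq0 setIDA PC0 set0D.
  have jPa : ejoin (P :|: (C :\: [set f])) x a.
    by rewrite -symdiff_disj //; apply: ejoin_symdiff jP (ejoinC jCf).
  by have := minP _ _ _ jPa; rewrite mu_disj //; move: muC Nfl;
     rewrite (mu_sub sfC); clear; lia.
rewrite in_setI => /andP[Ph Ch].
set Q := P :\: C; set W := component Q t.
(* P meets C away from t without using edges of C on the way. *)
have : [exists u in W, (u != t) &&
          [exists k' in C, ((ends k').1 == u) || ((ends k').2 == u)]].
  apply: contraT => /existsPn noU.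
  have {}noU u k' : u \in W -> k' \in C ->
      ((ends k').1 == u) || ((ends k').2 == u) -> u = t.
    move=> Wu Ck' Eu; have := noU u; rewrite Wu /= negb_and negbK.
    by case/orP=> [/eqP//|/existsPn/(_ k')]; rewrite Ck' Eu.
  (* An edge of [P] leaving [W] lies in [C], so its end in [W] is [t] and it is [e], which is not in
     [C]. Hence [x] is in [W], and a join inside [P] minus [C] must be all of [P], against the
     choice of [h]. *)
  have PW0 : P :&: cut W = set0.
    apply/setP=> k'; rewrite in_set0 in_setI; apply/negP=> /andP[Pk' Wk'].
    have Ck' : k' \in C.
      apply: contraLR Wk' => Ck'; rewrite in_set (@component_ends _ Q) ?addbb //.
      by rewrite in_setD Ck'.
    suff : k' \in P :&: cut [set t].
      by rewrite Pt in_set1 => /eqP k'e; rewrite -k'e Ck' in eC'.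
    have Wt : t \in W := component_refl Q t.
    rewrite in_setI Pk' !inE; move: Wk'; rewrite in_set.
    case W1: (_ \in W); case W2: (_ \in W) => //= _.
      rewrite (noU _ _ W1 Ck') ?eqxx //=.
      by apply: contraFN W2 => /eqP->.
    rewrite (noU _ _ W2 Ck') ?eqxx ?orbT //=.
    by rewrite addbT; apply: contraFN W1 => /eqP->.
  have := ejoin_cut W jP; rewrite PW0 cards0 component_refl addbT => /esym/negbFE.
  rewrite inE => /connect_ejoin[P' sP' jP'].
  have PE : P' = P.
    by apply: minPsub (ejoinC jP'); apply: subset_trans sP' (subsetDl _ _).
  by move: Ph; rewrite -PE => /(subsetP sP'); rewrite in_setD Ch.
case/existsP=> u /and3P[Wu nut /existsP[k' /andP[Ck' Ek']]].
(* The part of [C] in the component of [t] is a nonempty even subset, so [C] is connected. *)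
have Ctu : connect (adj_in C) t u.
  have iC : inside C (component C t) = C.
    apply: circ.
    - by apply/subsetP=> h'; rewrite inE => /andP[].
    - by apply: even_inside => //; apply: component_cut.
    apply/set0Pn; exists f; rewrite in_set Cf -(component_ends t Cf) andbb.
    have Ct' := component_refl C t; move: tf; rewrite !inE.
    case: eqP => [->|_]; first by rewrite connect0.
    by move/eqP=> E2; have := component_ends t Cf; rewrite E2 !inE connect0 => ->.
  move: Ck'; rewrite -{1}iC in_set => /and3P[_ h1 h2].
  by move: Ek' h1 h2; rewrite !inE => /orP[]/eqP->.
move: Wu; rewrite inE => /connect_ejoin[P1 sP1 jP1].
(* One of the two arcs of C from t to u closes the initial segment P1 of P, which
   has negative length, to an even set of negative length. *)
have [D [sDC jD sD0]] : exists D : {set edge G},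
    [/\ D \subset C, ejoin D t u & (slen J l D <= 0)%R].
  have [C1 sC1 jC1] := connect_ejoin Ctu.
  have := slen_sub J l sC1; rewrite sC0.
  case: (lerP (slen J l C1) 0) => [|C1p] sC12; first by exists C1.
  exists (C :\: C1); split; [exact: subsetDl | | by move: C1p sC12; clear; lia].
  by rewrite -symdiff_sub //; apply: ejoin_symdiff jC1; apply/ejoinxx.
have dP1 : [disjoint P1 & D].
  apply: (disjointWr sDC); apply: (disjointWl sP1).
  by rewrite -setI_eq0 setIDAC -setIDA setDv setI0.
have eP1D : even_set (P1 :|: D).
  rewrite -symdiff_disj //; apply/(ejoinxx _ t).
  exact: ejoin_symdiff jP1 (ejoinC jD).
have := conserv eP1D; rewrite slen_disj // => P1D0.
have sP1P : P1 \subset P by apply: subset_trans sP1 (subsetDl _ _).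
have jD1 : ejoin (P :\: P1) x u.
  by rewrite -symdiff_sub //; apply: ejoin_symdiff jP jP1.
(* Minimality against [P :\: P1] gives [mu P1 <= 0], while conservativeness on [P1 :|: D] makes the
   length of [P1] nonnegative. So [P1] is empty and [u] is [t], a contradiction. *)
have := minP _ _ _ jD1; rewrite (mu_sub sP1P) => muP1.
have {}muP1 : (mu P1 <= 0)%R by move: muP1; clear; lia.
have P10 : P1 = set0.
  apply/eqP; rewrite -cards_eq0; move: muP1; rewrite /mu.
  by have := @mulr_ge0 _ (slen J l P1) N%:Z; move: P1D0 sD0; clear; lia.
move: nut; rewrite P10 in jP1; rewrite (even_set_ejoin jP1) ?eqxx //.
by move=> v; rewrite deg_in0.
Qed.

End TightVertex.

(** * Contracting an edge of length zero *)

Section Contraction.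
Variables (G : multigraph) (e0 : edge G).
Hypothesis nonloop : (ends e0).1 != (ends e0).2.
Let a := (ends e0).1.
Let b := (ends e0).2.
Let phi (v : vert G) := if v == b then a else v.

(** Vertex and edge types are kept, so that [J] and the lengths carry over literally: [b] becomes
    isolated and [e0] a loop. *)
Definition contract : multigraph :=
  @Multigraph (vert G) (edge G) (fun f => (phi (ends f).1, phi (ends f).2)).

Lemma cut_contract (X : {set vert G}) : @cut contract X = cut (phi @^-1: X).
Proof. by apply/setP=> f; rewrite !inE. Qed.

Lemma deg_in_contract (C : {set edge G}) v :
  @deg_in contract C v =
    if v == b then 0 else if v == a then deg_in C a + deg_in C b else deg_in C v.
Proof.
have phiE w : nat_of_bool (phi w == v) =
    if v == b then 0 else if v == a then (w == a) + (w == b) else (w == v).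
  rewrite /phi; case: (eqVneq v b) => [->|vb].
    by case: (eqVneq w b) => [_|/negPf-> //]; rewrite (negPf nonloop).
  case: (eqVneq v a) => [->|va].
    case: (eqVneq w b) => [->|]; last by rewrite addn0.
    by rewrite eqxx eq_sym (negPf nonloop).
  case: (eqVneq w b) => [->|//].
  by rewrite eq_sym (negPf va) eq_sym (negPf vb).
rewrite /deg_in; under eq_bigr => f _ do rewrite /= !phiE.
case: ifP => _; first by rewrite big1.
case: ifP => _ //; rewrite -big_split /=; apply: eq_bigr => f _; lia.
Qed.

(** Evenness at the merged vertex makes the degrees at [a] and [b] agree modulo 2; if both are odd,
    toggling [e0] repairs them. *)
Lemma even_contract (C : {set edge G}) : @even_set contract C ->
  even_set C \/ even_set (symdiff C [set e0]).
Proof.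
move=> eC.
have eCa : odd (deg_in C a) = odd (deg_in C b).
  have := eC a; rewrite deg_in_contract eqxx (negPf nonloop) oddD.
  by case: (odd _); case: (odd _).
have eCv v : v != a -> v != b -> odd (deg_in C v) = false.
  move=> /negPf va /negPf vb; have := eC v; rewrite deg_in_contract va vb.
  by move/negPf.
case oa : (odd (deg_in C a)); [right|left] => [|v]; last first.
  case: (eqVneq v a) => [->|va]; first by rewrite oa.
  by case: (eqVneq v b) => [->|vb]; [rewrite -eCa oa | rewrite eCv].
apply/(ejoinxx _ a)/(ejoin_symdiff _ (ejoinC (ejoin1 e0))) => v.
case: (eqVneq v a) => [->|va]; first by rewrite oa (negPf nonloop).
by case: (eqVneq v b) => [->|vb]; [rewrite -eCa oa | rewrite eCv].
Qed.

End Contraction.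

Lemma slen_symdiff0 (G : multigraph) (J C : {set edge G}) (l : edge G -> nat) e :
  l e = 0 -> slen J l (symdiff C [set e]) = slen J l C.
Proof.
move=> le; rewrite /slen big_mkcond [RHS]big_mkcond; apply: eq_bigr => f _.
rewrite !inE; case: (eqVneq f e) => [->|]; last by rewrite addbF.
by rewrite le; case: (e \in J); case: (e \in C).
Qed.

(* Subdividing each edge e into l e edges would give a bipartite graph; the proof
   is Sebo's proof of Seymour's theorem there.  The stars of the tight vertices
   met along the way are disjoint T-cuts, each containing a single edge of J. *)
Lemma conservative_third (V E : finType) (J : {set E}) (en : E -> V * V)
    (l : E -> nat) (col : V -> bool) :
  let G := Multigraph en in
  (forall e, odd (l e) = col (en e).1 (+) col (en e).2) ->
  (forall C : {set edge G}, even_set C -> (0 <= slen J l C)%R) ->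
  (forall X : {set vert G}, odd #|J :&: cut X| -> 3 <= #|cut X|) ->
  3 * \sum_(e in J) l e <= \sum_e l e.
Proof.
(* Contraction lowers the number of non-loops, shortening a star lowers the total length. *)
have [n] := ubnP (\sum_e l e + #|[set e | (en e).1 != (en e).2]|).
elim: n => // n IH in en l col * => lt_n G parl conservl cutJ.
have [/existsP[e /andP[/eqP le0 nl]] | /existsPn nz] :=
    boolP [exists e, (l e == 0) && ((en e).1 != (en e).2)].
  apply: (IH (@ends (@contract G e)) l col).
  - move: lt_n; rewrite ltnS; apply: leq_trans; rewrite ltn_add2l; apply: proper_card.
    apply/properP; split.
      apply/subsetP=> f; rewrite !inE /=; apply: contraNneq => ->.
      by rewrite eqxx.
    exists e; rewrite !inE //= negbK eqxx.
    by case: ifP.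
  - have cphi v : col (if v == (en e).2 then (en e).1 else v) = col v.
      case: eqP => // ->; apply/eqP; have := parl e; rewrite le0.
      by case: (col _); case: (col _).
    by move=> f; rewrite /= !cphi.
  - move=> C /(@even_contract G e nl)[/conservl//|/conservl].
    by rewrite (@slen_symdiff0 G).
  by move=> X; rewrite (@cut_contract G e); apply: cutJ.
have z e : l e = 0 -> (en e).1 = (en e).2.
  by move=> le; have := nz e; rewrite le /= negbK => /eqP.
case: (posnP (\sum_(e in J) l e)) => [-> //|].
rewrite lt0n sum_nat_eq0 => /forallPn/=[j]; rewrite negb_imply -lt0n => /andP[Jj lj].
have [|t [e [Jt conserv']]] := @tight_vertex G J l col z parl conservl;
  first by exists j.
pose c f := nat_of_bool (f \in @cut G [set t]).
have lc f : l f = (l f - c f) + c f.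
  by rewrite subnK // /c; case tf: (f \in _) => //; apply: cut1_len tf.
have sumc (A : {set E}) : \sum_(f in A) l f =
    \sum_(f in A) (l f - c f) + #|A :&: @cut G [set t]|.
  rewrite (eq_bigr _ (fun f _ => lc f)) big_split /=; congr (_ + _).
  rewrite -sum1_card big_mkcond [RHS]big_mkcond; apply: eq_bigr => f _.
  by rewrite in_setI /c; case: (f \in A); case: (f \in _).
(* The shortening takes exactly 3 from the left side, one edge of [J], and at least 3 from the
   right. *)
have cut3 : 3 <= #|@cut G [set t]| by apply: cutJ; rewrite Jt cards1.
have sumT : \sum_f l f = \sum_f (l f - c f) + #|@cut G [set t]|.
  by have := sumc setT; rewrite setTI !(eq_bigl _ _ (@in_setT E)).
rewrite sumc Jt cards1 sumT mulnDr leq_add //.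
(* Flipping the colour of [t] matches the parity change on its star. *)
apply: (IH en _ (fun v => col v (+) (v == t))) => //.
  by move: lt_n; rewrite sumT; lia.
move=> f; have := parl f; rewrite {1}lc oddD /c !inE.
by case: (odd _); case: (col _); case: (col _); case: (_ == t); case: (_ == t).
Qed.

(** * Cut-edges and components *)

Section Components.
Variable G : multigraph.
Implicit Types (u v w : vert G) (e b : edge G) (F Q C B : {set edge G}).
Implicit Types (K X : {set vert G}).

Definition components F : {set {set vert G}} := [set component F v | v in vert G].

Lemma mem_components F v : component F v \in components F.
Proof. exact: imset_f. Qed.

Lemma eq_component F u v : u \in component F v -> component F u = component F v.
Proof.
rewrite inE => vu; apply/setP=> w; rewrite !inE.
apply/idP/idP; first exact: connect_trans.
by apply: connect_trans; rewrite connect_adj_sym.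
Qed.

Lemma components_mem F K v : K \in components F -> v \in K -> K = component F v.
Proof. by case/imsetP=> w _ -> /eq_component. Qed.

Lemma ncompE F : ncomp F = #|components F|.
Proof.
have sc := @connect_adj_sym G F.
rewrite /ncomp /n_comp_mem.
have -> : components F = (component F) @: [set v | v \in roots (adj_in F)].
  apply/setP=> K; apply/imsetP/imsetP => -[v hv ->]; last by exists v.
  exists (fingraph.root (adj_in F) v); first by rewrite inE; apply: roots_root.
  by apply/esym/eq_component; rewrite inE connect_root.
rewrite card_in_imset; first by apply: eq_card => v; rewrite !inE andbT.
move=> u v; rewrite !inE => /eqP ru /eqP rv E.
have := component_refl F v; rewrite -E inE => /(fingraph.rootP sc).
by rewrite ru rv.
Qed.

Lemma sum_components F (f : vert G -> nat) :
  \sum_v f v = \sum_(K in components F) \sum_(v in K) f v.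
Proof.
rewrite (partition_big (component F) (mem (components F))) /=; last first.
  by move=> v _; apply: mem_components.
apply: eq_bigr => K hK; apply: eq_bigl => v.
apply/eqP/idP => [<-|vK]; first exact: component_refl.
by rewrite (components_mem hK vK).
Qed.

(** The map [h] sends the components of [F] onto those of [Q] and identifies the components of [u]
    and [v]. *)
Lemma ncomp_lt F Q u v : F \subset Q -> connect (adj_in Q) u v ->
  ~~ connect (adj_in F) u v -> ncomp Q < ncomp F.
Proof.
move=> sFQ Quv Fuv; rewrite !ncompE.
have sub w : component F w \subset component Q w.
  apply/subsetP=> z; rewrite !inE; apply: connect_sub => x y xy.
  exact/connect1/(sub_adj_in sFQ).
pose h (K : {set vert G}) := \bigcup_(w in K) component Q w.
have hE w : h (component F w) = component Q w.
  apply/setP=> z; apply/bigcupP/idP => [[y /(subsetP (sub w)) yw]|zw].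
    by rewrite (eq_component yw).
  by exists w; rewrite ?component_refl.
rewrite (cardsD1 (component F v) (components F)) mem_components ltnS.
apply: leq_trans (leq_imset_card h _); apply/subset_leq_card/subsetP=> K.
case/imsetP=> w _ ->; apply/imsetP.
have [wv|nwv] := eqVneq (component F w) (component F v).
  exists (component F u); last first.
    rewrite hE -hE wv hE; apply: eq_component; by rewrite inE.
  rewrite !inE mem_components andbT; apply: contraNneq Fuv => uv.
  by have := component_refl F v; rewrite -uv inE.
by exists (component F w); rewrite ?hE // !inE nwv mem_components.
Qed.

Lemma cut_edgeE e : cut_edge e = ~~ connect (adj_in [set~ e]) (ends e).1 (ends e).2.
Proof.
apply/idP/idP; last first.
  by apply: ncomp_lt; rewrite ?subsetT //; apply/connect1/adj_in_ends.
apply: contraL => he; rewrite /cut_edge -leqNgt leq_eqVlt; apply/orP; left.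
apply/eqP/eq_n_comp => u v; apply/idP/idP; apply: connect_sub => x y.
  by move/(sub_adj_in (subsetT _))/connect1.
case/existsP=> f /andP[_ xy]; have [fe|nfe] := eqVneq f e; last first.
  by apply/connect1/existsP; exists f; rewrite !inE nfe.
move: xy he; rewrite fe => /orP[]/eqP->//=; by rewrite connect_adj_sym.
Qed.

Lemma cut_edge_cut b : cut_edge b -> exists X, cut X = [set b].
Proof.
rewrite cut_edgeE => hb; exists (component [set~ b] (ends b).1).
apply/setP=> f; rewrite in_set1; have [->|nfb] := eqVneq f b.
  by rewrite in_set component_refl inE (negPf hb).
by rewrite in_set (@component_ends _ [set~ b]) ?addbb // !inE.
Qed.

Definition noncut : {set edge G} := [set e | ~~ cut_edge e].

Lemma even_noncut C : even_set C -> C \subset noncut.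
Proof.
move=> eC; apply/subsetP=> b Cb; rewrite inE; apply/negP=> /cut_edge_cut[X Xb].
have := even_set_cut X eC; rewrite Xb (setIidPr _) ?sub1set ?cards1 //.
Qed.

Lemma noncut_even e : e \in noncut -> exists2 C : {set edge G}, even_set C & e \in C.
Proof.
rewrite inE cut_edgeE negbK => /connect_ejoin[P sP jP].
exists (symdiff [set e] P).
  exact/(ejoinxx _ (ends e).1)/(ejoin_symdiff (ejoin1 e) (ejoinC jP)).
rewrite !inE eqxx /=; apply/negP=> /(subsetP sP); by rewrite !inE eqxx.
Qed.

(** A single crossing edge would lie in an even set contained in [noncut], which crosses [X]
    evenly. *)
Lemma noncut_cut X : #|noncut :&: cut X| != 1.
Proof.
apply/negP=> /cards1P[e E].
have : e \in noncut :&: cut X by rewrite E inE.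
rewrite in_setI => /andP[/noncut_even[C eC Ce] Xe].
have := even_set_cut X eC; rewrite -(setIidPl (even_noncut eC)) -setIA E.
by rewrite (setIidPr _) ?sub1set ?cards1.
Qed.

(** Cut-edges are deleted one at a time: each still separates its ends after the others are gone, so
    each deletion adds a component. *)
Lemma ncomp_noncut : ncomp [set: edge G] + num_cut_edges G <= ncomp noncut.
Proof.
have -> : noncut = ~: [set e | cut_edge e] by apply/setP=> e; rewrite !inE.
rewrite /num_cut_edges.
have : forall b, b \in [set e : edge G | cut_edge e] -> cut_edge b.
  by move=> b; rewrite inE.
move: [set e | cut_edge e] => B.
have [n] := ubnP #|B|; elim: n B => // n IH B Bn cutB.
case: (set_0Vmem B) => [->|[b Bb]]; first by rewrite cards0 addn0 setC0.
have := IH (B :\ b); rewrite (cardsD1 b) Bb addnCA add1n in Bn *.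
move=> /(_ Bn) h; apply: leq_ltn_trans (h _) _.
  by move=> f /setD1P[_ /cutB].
apply: (@ncomp_lt _ _ (ends b).1 (ends b).2).
- by rewrite setCS subD1set.
- by apply/connect1/adj_in_ends; rewrite !inE eqxx.
have := cutB _ Bb; rewrite cut_edgeE; apply: contra; apply: connect_sub => x y.
move=> xy; apply/connect1/(sub_adj_in _ xy).
by apply/subsetP=> f; rewrite !inE; apply: contraNneq => ->.
Qed.

End Components.

(** * Maximum even sets inside a component without cut-edges *)

Section LargeEvenSet.
Variable G : multigraph.
Implicit Types (v w : vert G) (e : edge G) (Q C : {set edge G}) (K X : {set vert G}).

Lemma ex_max_even_set :
  exists2 C : {set edge G}, even_set C &
    forall Q : {set edge G}, even_set Q -> #|Q| <= #|C|.
Proof.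
pose evenb (C : {set edge G}) := [forall v, ~~ odd (deg_in C v)].
have evenP C : reflect (even_set C) (evenb C) by apply: forallP.
have even0 : evenb set0 by apply/evenP=> v; rewrite deg_in0.
case: (arg_maxnP (fun C : {set edge G} => #|C|) even0) => C /evenP eC maxC.
by exists C => // Q /evenP; apply: maxC.
Qed.

Lemma components_cut (F : {set edge G}) K Q :
  K \in components F -> Q \subset F -> Q :&: cut K = set0.
Proof. by case/imsetP=> w _ ->; apply: component_cut. Qed.

(** Equivalently, [C] misses at most a third of the edges of [EK]; this is [conservative_third] for
    the missed edges. *)
Lemma max_even_set_component C K :
  even_set C -> (forall Q, even_set Q -> #|Q| <= #|C|) -> K \in components (noncut G) ->
  2 * #|inside (noncut G) K| <= 3 * #|inside C K|.
Proof.
move=> eC maxC hK; set EK := inside (noncut G) K.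
(* Length 2 rather than 1 makes all lengths even, so a constant colouring satisfies the parity
   condition; the edges outside [EK] get contracted. *)
pose l e := if e \in EK then 2 else 0.
have insideE Q : Q \subset noncut G -> inside Q K = Q :&: EK.
  move=> sQ; apply/setP=> e; rewrite !in_set.
  by case Qe: (e \in Q) => //=; have := subsetP sQ e Qe; rewrite inE => ->.
have suml (A : {set edge G}) : \sum_(e in A) l e = 2 * #|A :&: EK|.
  rewrite -sum1_card big_distrr /= big_mkcond [RHS]big_mkcond; apply: eq_bigr => e _.
  by rewrite in_setI /l; case: (e \in A); case: (e \in EK).
have suml1 : \sum_e l e = 2 * #|EK|.
  by have := suml setT; rewrite setTI (eq_bigl _ _ (@in_setT _)).
have CE := insideE _ (even_noncut eC).
suff : 3 * \sum_(e in EK :\: C) l e <= \sum_e l e.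
  rewrite suml suml1 CE.
  have -> : (EK :\: C) :&: EK = EK :\: C by apply/setIidPl/subsetDl.
  by have := cardsID C EK; rewrite (setIC C); lia.
apply: (@conservative_third _ _ _ (@ends G) l (fun=> false)).
- by move=> e; rewrite /l; case: ifP.
- change (forall Q : {set edge G}, even_set Q -> (0 <= slen (EK :\: C) l Q)%R).
  (* Nonnegativity on [Q] says that exchanging [C] along [Q :&: EK] does not enlarge it. *)
  move=> Q eQ.
  have sQ := even_noncut eQ.
  have eQ' : even_set (inside Q K).
    by apply: even_inside => //; apply: components_cut hK sQ.
  have := maxC _ (even_symdiff eC eQ'); rewrite (insideE _ sQ).
  have := slenE (EK :\: C) l Q; rewrite !suml.
  set S := symdiff _ _ => sl.
  have := cardsID C S; have -> : S :&: C = C :\: (Q :&: EK).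
    by apply/setP=> e; rewrite !inE; case: (e \in C); rewrite /= ?andbT ?andbF.
  have -> : S :\: C = Q :&: (EK :\: C) :&: EK.
    apply/setP=> e; rewrite in_setD [e \in S]in_set !in_setI in_setD.
    by case: (e \in C); case: (e \in Q); case: (e \in EK).
  have := cardsID (Q :&: EK) C.
  have -> : C :&: (Q :&: EK) = (Q :\: (EK :\: C)) :&: EK.
    apply/setP=> e; rewrite !in_setI !in_setD.
    by case: (e \in C); case: (e \in Q); case: (e \in EK).
  by move: sl; clear; lia.
change (forall X : {set vert G}, odd #|(EK :\: C) :&: cut X| -> 3 <= #|cut X|).
(* The edges of [EK] crossing [X] are the edges of [noncut G] leaving [Y]. Their number is odd
   because [C] meets the cut evenly, and it is not 1 by [noncut_cut]. *)
move=> X oX; pose Y := X :&: K.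
have K0 : noncut G :&: cut K = set0 by apply: components_cut hK _.
have cutY : noncut G :&: cut Y = EK :&: cut X.
  apply/setP=> e; move/setP/(_ e): K0; rewrite !inE.
  by case: (~~ _) => //=; case: (_ \in K); case: (_ \in K); rewrite ?andbT ?andbF.
have h : #|noncut G :&: cut Y| = #|C :&: cut Y| + #|(EK :\: C) :&: cut X|.
  rewrite -(cardsID C (noncut G :&: cut Y)); congr (_ + _).
    by rewrite setIAC (setIidPr (even_noncut eC)).
  by rewrite cutY setIDAC.
have := noncut_cut Y; have := even_set_cut Y eC.
have : #|noncut G :&: cut Y| <= #|cut X| by rewrite cutY subset_leq_card ?subsetIr.
have : odd #|noncut G :&: cut Y|.
  by rewrite h oddD oX (negPf (even_set_cut Y eC)).
by move: #|noncut _ :&: _| => [|[|[|]]] //=; clear; lia.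
Qed.

End LargeEvenSet.

(** * Summing deficits over the components *)

Section Subcubic.
Variable G : multigraph.
Hypothesis maxdeg : max_degree G <= 3.

Lemma deg_le3 (Q : {set edge G}) v : deg_in Q v <= 3.
Proof.
apply: leq_trans (deg_in_sub v (subsetT Q)) _.
by apply: leq_trans maxdeg; apply: (bigop.bigmax_sup v).
Qed.

Let def v := 3 - deg_in (noncut G) v.
Let cdef (K : {set vert G}) := \sum_(v in K) def v.

Lemma defD v : def v + deg_in (noncut G) v = 3.
Proof. by rewrite subnK ?deg_le3. Qed.

(** Without deficit every vertex of the component already has degree 3 in [noncut G], so no cut-edge
    is attached to it. *)
Lemma cdef0_component w :
  cdef (component (noncut G) w) = 0 -> component (noncut G) w = component setT w.
Proof.
set K := component _ w => /eqP; rewrite sum_nat_eq0 => /forallP/= K0.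
have degB v : v \in K -> deg_in (~: noncut G) v = 0.
  move=> Kv; have := K0 v; rewrite Kv /= => /eqP d0.
  have := defD v; have := deg_le3 setT v; rewrite (deg_inID setT (noncut G)).
  by rewrite setTI setTD d0; clear; lia.
have cutK : cut K = set0.
  apply/setP=> e; rewrite in_set0; case Ne: (e \in noncut G).
    by rewrite in_set (component_ends _ Ne) addbb.
  apply/negP; rewrite in_set => Ke.
  have [v Kv ve] : exists2 v, v \in K & ((ends e).1 == v) || ((ends e).2 == v).
    move: Ke; case K1: ((ends e).1 \in K) => /= K2.
      by exists (ends e).1; rewrite ?eqxx.
    by exists (ends e).2; rewrite ?eqxx ?orbT.
  have := degB v Kv; rewrite /deg_in (bigD1 e) /=; last by rewrite in_setC Ne.
  by case/orP: ve => ->; rewrite ?addn1.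
apply/setP=> u; apply/idP/idP => [|].
  rewrite /K !inE; apply: connect_sub => x y xy.
  exact/connect1/(sub_adj_in (subsetT _) xy).
rewrite [in X in X -> _]inE => /connect_ejoin[P _ /(ejoin_cut K)].
by rewrite cutK setI0 cards0 component_refl /=; case: (u \in K).
Qed.

(** Components of deficit 0 are components of [G], and the one containing [v0] is not among them. So
    they number fewer than [ncomp setT], whereas [ncomp_noncut] gives at least [ncomp setT] plus the
    number of cut-edges in all. *)
Lemma num_positive_components v0 : 0 < cdef (component (noncut G) v0) ->
  num_cut_edges G < #|[set K in components (noncut G) | 0 < cdef K]|.
Proof.
move=> v0pos; set pos := [set K in _ | _].
set Z := components (noncut G) :\: pos.
have ZP K : K \in Z -> K \in components (noncut G) /\ cdef K = 0.
  rewrite !inE; case: (K \in components _) => //=; rewrite ?andbF // andbT => h.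
  by split=> //; apply/eqP; rewrite -leqn0 leqNgt.
have ltZ : #|Z| < ncomp [set: edge G].
  rewrite ncompE; apply: proper_card; apply/properP; split.
    apply/subsetP=> K /ZP[/imsetP[w _ ->] /cdef0_component->].
    exact: mem_components.
  exists (component setT v0); first exact: mem_components.
  apply/negP=> /ZP[hL L0]; move: v0pos.
  by rewrite -(components_mem hL (component_refl _ v0)) L0.
have := ncomp_noncut G; rewrite (ncompE (noncut G)).
rewrite -(cardsID pos (components (noncut G))).
rewrite (setIidPr _) -/Z; last by apply/subsetP=> K; rewrite inE => /andP[].
by move: ltZ; clear; lia.
Qed.

(** The two cases are the two arguments of the maximum, cleared of subtraction and of the
    denominator 2. *)
Theorem f2_bound_nat :
  #|vert G| <= f2 G \/
  2 * #|vert G| + 2 * #|edge G| + 1 <= 2 * f2 G + 3 * #|vert G| + num_cut_edges G.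
Proof.
have [C eC maxC] := ex_max_even_set G.
pose H := [set v | 0 < deg_in C v].
have degC v : deg_in C v = 2 * (v \in H).
  by rewrite inE; have := eC v; have := deg_le3 C v; case: (deg_in C v) => [|[|[|[|]]]].
have f2H : #|H| <= f2 G.
  apply: (@leq_bigmax_cond _ (fun H => subgraph H && two_regular H)
            (fun H : {set vert G} * {set edge G} => #|H.1|) (H, C)).
  apply/andP; split; last by apply/forall_inP => v /= Hv; rewrite degC Hv.
  apply/forall_inP => e /= Ce.
  have He v : ((ends e).1 == v) || ((ends e).2 == v) -> v \in H.
    by rewrite inE /deg_in (bigD1 e) //=; case: (_ == v); case: (_ == v).
  by rewrite !He ?eqxx ?orbT.
pose un K := #|K :\: H|.
(* Degree sums turn the edge counts of [max_even_set_component] into vertex counts. *)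
have unK K : K \in components (noncut G) -> 3 * un K <= cdef K.
  move=> hK; have := max_even_set_component eC maxC hK.
  have := sum_deg_in (noncut G) K; have := sum_deg_in C K.
  rewrite (components_cut hK (even_noncut eC)) (components_cut hK (subxx _)) cards0.
  under eq_bigr => v _ do rewrite degC.
  have -> : \sum_(v in K) 2 * (v \in H) = 2 * #|K :&: H|.
    rewrite -big_distrr -sum1_card /= big_mkcond [in RHS]big_mkcond /=.
    congr (_ * _); apply: eq_bigr => v _.
    by rewrite in_setI; case: (v \in K); case: (v \in H).
  have : cdef K + \sum_(v in K) deg_in (noncut G) v = 3 * #|K|.
    rewrite -big_split /= (eq_bigr _ (fun v _ => defD v)) sum_nat_const.
    exact: mulnC.
  by rewrite /un -(cardsID H K); clear; lia.
have sum_un : #|~: H| = \sum_(K in components (noncut G)) un K.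
  rewrite -sum1_card big_mkcond (sum_components (noncut G)); apply: eq_bigr => K _.
  rewrite /un -sum1_card big_mkcond [RHS]big_mkcond; apply: eq_bigr => v _.
  by rewrite !inE; case: (v \in K); case: (_ < _).
have sum_def :
    \sum_(K in components (noncut G)) cdef K + 2 * #|noncut G| = 3 * #|vert G|.
  rewrite -sum_components.
  have := sum_deg_in (noncut G) setT.
  have -> : cut [set: vert G] = set0 by apply/setP=> e; rewrite !inE.
  have -> : inside (noncut G) setT = noncut G by apply/setP=> e; rewrite !inE !andbT.
  rewrite setI0 cards0 add0n -mul2n => <-.
  rewrite (eq_bigl _ _ (@in_setT _)) -big_split /=.
  rewrite (eq_bigr _ (fun v _ => defD v)) sum_nat_const.
  exact: mulnC.
have card_noncut : num_cut_edges G + #|noncut G| = #|edge G|.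
  rewrite -(cardsC [set e | cut_edge e]); congr (_ + _).
  by apply: eq_card => e; rewrite !inE.
have cardH := cardsC H.
pose pos := [set K in components (noncut G) | 0 < cdef K].
(* If [un K] is positive, then [2 * un K + 1 <= 3 * un K]; otherwise the indicator alone is at most
   [cdef K]. *)
have sum_pos : \sum_(K in components (noncut G)) (2 * un K + (0 < cdef K)) <=
    \sum_(K in components (noncut G)) cdef K.
  by apply: leq_sum => K /unK; case: (cdef K); clear; lia.
have card_pos : \sum_(K in components (noncut G)) (0 < cdef K) = #|pos|.
  rewrite -sum1_card big_mkcond [RHS]big_mkcond; apply: eq_bigr => K _.
  by rewrite inE; case: (K \in _) => //; case: (0 < _).
rewrite big_split /= -big_distrr /= -sum_un card_pos in sum_pos.
have [pos0|[K]] := set_0Vmem pos.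
  left; suff u0 : #|~: H| = 0 by move: cardH f2H; rewrite u0; clear; lia.
  rewrite sum_un big1 // => K hK; have := unK K hK.
  have /setP/(_ K) := pos0; rewrite in_set0 inE hK /=.
  by case: (cdef K) => //; clear; lia.
rewrite inE => /andP[/imsetP[w _ ->]] /num_positive_components => ltc.
right; move: ltc sum_pos sum_def card_noncut cardH f2H; rewrite -/pos.
set S := \sum_(_ in _) _; move: (num_cut_edges G) (f2 G) S.
move: #|pos| #|~: H| #|H| #|noncut G| #|vert G| #|edge G|.
by clear; lia.
Qed.

End Subcubic.

(** * Sharpness *)

(** Disjoint copies of two vertices joined by three parallel edges: cubic without cut-edges, so the
    bound equals the number of vertices. *)
Definition theta_union (N : nat) : multigraph :=
  @Multigraph ('I_N * bool)%type ('I_N * 'I_3)%type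
    (fun e => ((e.1, false), (e.1, true))).

Lemma theta_union_deg N v : @deg_in (theta_union N) setT v <= 3.
Proof.
case: v => i b; rewrite /deg_in (eq_bigl _ _ (@in_setT _)) /=.
rewrite -(pair_bigA _ (fun j (_ : 'I_3) =>
   ((j, false) == (i, b)) + ((j, true) == (i, b)))) /=.
rewrite (bigD1 i) //= [X in _ + X]big1 => [|j ji].
  by rewrite addn0 sum_nat_const card_ord; case: b; rewrite !xpair_eqE eqxx.
by rewrite sum_nat_const !xpair_eqE (negPf ji) muln0.
Qed.

Lemma theta_union_maxdeg N : max_degree (theta_union N) <= 3.
Proof. by apply/bigmax_leqP => v _; apply: theta_union_deg. Qed.

Lemma theta_union_cut N : num_cut_edges (theta_union N) = 0.
Proof.
apply/eqP; rewrite cards_eq0; apply/eqP/setP=> -[i k].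
rewrite !inE cut_edgeE; apply/negbF/connect1/existsP => /=.
(* A parallel edge of the same copy keeps the ends connected. *)
exists (i, if k == ord0 then ord_max else ord0); rewrite !inE xpair_eqE !eqxx /=.
by case: ifP => [/eqP->|]; rewrite // eq_sym => ->.
Qed.

Lemma theta_union_deficit N : deficit (theta_union N) = 0.
Proof. by rewrite /deficit !card_prod !card_ord card_bool; lia. Qed.

Local Open Scope ring_scope.

Lemma f2_bound (G : multigraph) : (max_degree G <= 3)%N ->
  (f2 G)%:R >= #|vert G|%:R
    - Num.max 0 (((deficit G)%:~R + (num_cut_edges G)%:R - 1) / 2) :> rat.
Proof.
move=> maxdeg; case: (f2_bound_nat maxdeg) => [h|h]; rewrite lerBlDr.
  apply: (@le_trans _ _ (f2 G)%:R); first by rewrite ler_nat.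
  by rewrite lerDl le_max lexx.
move: h; rewrite -(ler_nat rat) !natrD.
have -> : (deficit G)%:~R = 3 * #|vert G|%:R - 2 * #|edge G|%:R :> rat.
  by rewrite /deficit intrB !intrM -!pmulrn.
set x := (_ - 1) / 2; have : x <= Num.max 0 x by rewrite le_max lexx orbT.
by move: (Num.max 0 x); rewrite /x => M; lra.
Qed.

Lemma f2_le (G : multigraph) : (f2 G <= #|vert G|)%N.
Proof. by apply/bigmax_leqP => H _; apply: max_card. Qed.

Theorem theorem1p3 :
  (forall (G : multigraph) (n c : nat) (d : int),
     (max_degree G <= 3)%N ->
     #|vert G| = n ->
     num_cut_edges G = c ->
     deficit G = d ->
     (f2 G)%:R >= n%:R - Num.max 0 ((d%:~R + c%:R - 1) / 2) :> rat)
  /\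
  (forall N : nat, exists (G : multigraph) (n c : nat) (d : int),
     (N <= n)%N /\
     (max_degree G <= 3)%N /\
     #|vert G| = n /\
     num_cut_edges G = c /\
     deficit G = d /\
     (f2 G)%:R = n%:R - Num.max 0 ((d%:~R + c%:R - 1) / 2) :> rat).
Proof.
split=> [G _ _ _ maxdeg <- <- <- | N]; first exact: f2_bound.
exists (theta_union N), #|vert (theta_union N)|, 0%N, 0; do 5?split=> //.
- by rewrite card_prod card_ord card_bool leq_pmulr.
- exact: theta_union_maxdeg.
- exact: theta_union_cut.
- exact: theta_union_deficit.
(* The second argument is [-1/2], so the maximum is 0 and [f2_le] supplies the reverse
   inequality. *)
have max0 : Num.max 0 ((0%:~R + 0%:R - 1) / 2) = 0 :> rat by apply: max_l; lra.
have := f2_bound (theta_union_maxdeg N).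
rewrite theta_union_cut theta_union_deficit max0 !subr0 => h.
by apply/eqP; rewrite eq_le h ler_nat f2_le.
Qed.
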